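(* For every integer $n\ge 1$, $$\sum_{T\in\mathcal{A}_n}\mathrm{wt}(T)=\prod_{i=1}^{n-1}\big(iX_i+(n+1-i)\big),$$ where $\mathcal{A}_n$ is the set of André trees on $n$ vertices and $$\mathrm{wt}(T)=\prod_{\substack{1\le i\le n\\ h_i(T)>1}}\Big(X_{i-1}\big(h_i(T)-1\big)+2\Big).$$
   Context: An André tree on $n$ vertices is a rooted labelled tree such that each internal (non-leaf) vertex has either one or two children, children being unordered, and the vertices are labelled bijectively with the integers $1,\dots,n$, decreasingly from the root to the leaves (each vertex has a larger label than its children). $\mathcal{A}_n$ denotes the set of André trees with $n$ vertices. For $1\le i\le n$, the hook length $h_i(T)$ is the number of vertices below the vertex with label $i$ in $T$, including itself (i.e. the size of the subtree rooted at it). $X_0,X_1,X_2,\dots$ are commuting indeterminates. *)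

(* Defs.v *)
From mathcomp Require Import all_boot all_order all_algebra.
From mathcomp Require Import finmap monalg.

Set Implicit Arguments.
Unset Strict Implicit.
Unset Printing Implicit Defensive.

Import GRing.Theory.
Local Open Scope ring_scope.

Section AndreTrees.

Variable n : nat.

(* The vertices are identified with their labels: [v : 'I_n] is the vertex    *)
(* labelled [v.+1].  Labels being pairwise distinct, a rooted labelled tree   *)
(* with unordered children is determined by the partial function sending each *)
(* vertex to its parent, and distinct parent functions are distinct trees.    *)
Definition parent_fun := {ffun 'I_n -> option 'I_n}.

Implicit Types (T : parent_fun) (u v r : 'I_n).

Definition label v : nat := v.+1.

Definition is_parent T : rel 'I_n := [rel u v | T u == Some v].

Definition children T v : {set 'I_n} := [set u | is_parent T u v].

(* A parentless vertex reached from every vertex by iterating [T]; this       *)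
(* entails acyclicity and uniqueness of the root, and excludes [n = 0].       *)
Definition rooted_tree T : bool :=
  [exists r, (T r == None) && [forall v, connect (is_parent T) v r]].

Definition decreasing T : bool :=
  [forall u, forall v, is_parent T u v ==> (label u < label v)%N].

(* Leaves have no children, internal vertices have one or two. *)
Definition unary_binary T : bool := [forall v, (#|children T v| <= 2)%N].

Definition andre_trees : {set parent_fun} :=
  [set T | [&& rooted_tree T, decreasing T & unary_binary T]].

(* [connect] is reflexive, so [v] itself is counted. *)
Definition hook T v : nat := #|[set u | connect (is_parent T) u v]|.

End AndreTrees.

(* Integer polynomials in the infinitely many commuting indeterminates        *)
(* [indet 0], [indet 1], ...: the algebra of the free commutative monoid on   *)
(* nat, where [ucm i] is the i-th generator.                                  *)
Notation polyZX := {malg int[{cmonom nat}]}.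

Definition indet (i : nat) : polyZX := << ucm i >>.

Definition wt (n : nat) (T : parent_fun n) : polyZX :=
  \prod_(v < n | (1 < hook T v)%N)
     (indet (label v).-1 * (hook T v - 1)%N%:R + 2%:R).

(* Main.v *)
(* Build the tree by adding the vertices in increasing order: vertex i is      *)
(* placed above a set S of at most two roots of the decreasing forest on       *)
(* 1, ..., i - 1.  The weight of vertex i is affine in the total hook length   *)
(* of S, and the hook lengths of all the k roots sum to i - 1; so the sum of   *)
(* these weights over the S of a given size depends on the forest only         *)
(* through k.  Hence so does the total weight of the completions to a tree,    *)
(* which has the closed form root_count_wt below.                              *)

Require Import Defs.
From mathcomp Require Import all_boot all_order all_algebra.
From mathcomp Require Import finmap monalg.
From mathcomp Require Import ring.

Set Implicit Arguments.
Unset Strict Implicit.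

Import GRing.Theory.
Local Open Scope ring_scope.

(** Placing vertex [i] (label i + 1) above 0, 1 or 2 of the k roots of a forest leaves k + 1, k or k
    - 1 roots. By [sum_draws_sum] and [sum_hook_roots], the weights of [i] over these choices add up
    to 1, i * x_i + 2k and i(k - 1) * x_i + k(k - 1), whatever the forest ([sum_vertex_wt]). The
    resulting recurrence is solved by [root_count_wt] ([root_count_wtS]), so [weighted_sum i] is
    constant for 1 <= i <= n ([weighted_sumS]). At i = 1 it is the product. At i = n the falling
    factorial of 0 retains only the forests with one root, which are the André trees
    ([andre_treesE]). *)

(** * Falling factorial identities *)

Lemma ffact_succ_pred m k : (m.+1 ^_ k = m ^_ k + k * m ^_ k.-1)%N.
Proof.
case: k => [|k]; first by rewrite !ffactn0.
by rewrite -!bin_ffact binS mulnDl factS /=; congr addn; rewrite mulnCA.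
Qed.

(** The left side is the falling factorial of m + 2 of length k + 1; apply [ffact_succ_pred]
    twice. *)
Lemma ffact_second_difference m k :
  (m.+2 * m.+1 ^_ k = m ^_ k.+1 + k.+1.*2 * m ^_ k + k.+1 * k * m ^_ k.-1)%N.
Proof.
have := ffact_succ_pred m.+1 k.+1.
by rewrite ffactSS => ->; rewrite !ffact_succ_pred /= -muln2; ring.
Qed.

(** * Double counting over subsets of fixed size *)

Section Subsets.

Variables (T : finType) (A : {set T}).

Lemma card_draws_containing k x : x \in A ->
  #|[set B : {set T} | [&& B \subset A, #|B| == k.+1 & x \in B]]| = 'C(#|A|.-1, k).
Proof.
move=> xA; have cA : #|A| = #|A :\ x|.+1 by rewrite (cardsD1 x) xA.
pose D := [set B : {set T} | B \subset A & #|B| == k.+1].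
have := cardsID [set B : {set T} | x \in B] D.
rewrite cards_draws [in 'C(_, k.+1)]cA binS addnC cA /=.
have -> : D :\: [set B : {set T} | x \in B] =
          [set B : {set T} | B \subset A :\ x & #|B| == k.+1].
  by apply/setP=> B; rewrite !inE subsetD1; case: (_ \subset _); case: (_ \in _); case: (_ == _).
rewrite cards_draws => /addnI <-; apply: eq_card => B.
by rewrite !inE andbA.
Qed.

(** Each [x] in [A] is counted once for every draw containing it, and the number of these draws is
    the same for all [x]. *)
Lemma sum_draws_sum k (h : T -> nat) :
  (\sum_(B : {set T} | (B \subset A) && (#|B| == k.+1)) \sum_(x in B) h x
   = 'C(#|A|.-1, k) * \sum_(x in A) h x)%N.
Proof.
rewrite (exchange_big_dep (mem A)) /=; last first.
  by move=> B x /andP[/subsetP sBA _] /sBA.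
rewrite big_distrr; apply: eq_bigr => x xA /=.
rewrite sum_nat_const -(card_draws_containing k xA); congr (_ * _)%N.
by apply: eq_card => B; rewrite !inE andbA.
Qed.

Lemma sum_subset_card_le (V : nmodType) m (F : {set T} -> V) :
  \sum_(B : {set T} | (B \subset A) && (#|B| <= m)%N) F B =
  \sum_(k < m.+1) \sum_(B : {set T} | (B \subset A) && (#|B| == k)) F B.
Proof.
rewrite [RHS](exchange_big_dep
  (fun B : {set T} => (B \subset A) && (#|B| <= m)%N)) /=; last first.
  by move=> k B _ /andP[-> /eqP->]; rewrite -ltnS ltn_ord.
apply: eq_bigr => B /andP[BA Bm].
by rewrite (big_pred1 (Ordinal (Bm : (#|B| < m.+1)%N))) // => k; rewrite BA eq_sym.
Qed.

End Subsets.

(** * Decreasing forests and their roots *)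

Section Forests.

Variable n : nat.
Implicit Types (T : parent_fun n) (u v r p i : 'I_n) (S : {set 'I_n}).

Lemma connect_parentE T u v :
  connect (is_parent T) u v =
  (u == v) || (if T u is Some p then connect (is_parent T) p v else false).
Proof.
apply/idP/idP => [/connectP[[|p s] /= e ->]|]; first by rewrite eqxx.
  by case/andP: e => /eqP -> es; apply/orP; right; apply/connectP; exists s.
case/orP => [/eqP->|]; first exact: connect0.
case E: (T u) => [p|//]; apply: (connect_trans (connect1 _)).
exact/eqP.
Qed.

Lemma decreasingP T :
  reflect (forall u v, T u = Some v -> (u < v)%N) (decreasing T).
Proof.
apply: (iffP forallP) => [dT u v Tu|dT u].
  by move/forallP/(_ v): (dT u); rewrite /is_parent /= Tu eqxx.
by apply/forallP => v; apply/implyP => /eqP /dT.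
Qed.

(** Induction from parent to child: labels increase towards the root and are bounded, so n - u
    decreases. *)
Lemma decreasing_ind T (dT : decreasing T) (P : 'I_n -> Prop) :
  (forall u, (forall p, T u = Some p -> P p) -> P u) -> forall u, P u.
Proof.
move: dT => /decreasingP dT IH u; have [m] := ubnP (n - u).
elim: m u => // m IHm u um; apply: IH => p /dT up; apply: IHm.
by rewrite -ltnS; apply: leq_trans um; rewrite ltnS ltn_sub2l.
Qed.

Lemma connect_leq T u v :
  decreasing T -> connect (is_parent T) u v -> (u <= v)%N.
Proof.
move=> dT; elim/(decreasing_ind dT): u => // u IH.
rewrite connect_parentE => /orP[/eqP-> //|].
case E: (T u) => [p|//] /(IH _ E); apply: leq_trans.
by apply: ltnW; move/decreasingP: dT; apply.
Qed.

Lemma connect_root_exists T u : decreasing T ->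
  exists2 r, T r = None & connect (is_parent T) u r.
Proof.
move=> dT; elim/(decreasing_ind dT): u => // u IH.
case E: (T u) => [p|]; last by exists u.
by have [r Tr pr] := IH _ E; exists r; rewrite // connect_parentE E pr orbT.
Qed.

Lemma connect_root_uniq T u r s : decreasing T -> T r = None -> T s = None ->
  connect (is_parent T) u r -> connect (is_parent T) u s -> r = s.
Proof.
move=> dT Tr Ts; elim/(decreasing_ind dT): u => // u IH.
rewrite ![connect _ u _]connect_parentE; case E: (T u) => [p|].
  case: eqP => [ur|_]; first by rewrite -ur E in Tr.
  by case: eqP => [us|_]; [rewrite -us E in Ts | apply: IH].
by rewrite !orbF => /eqP <- /eqP <-.
Qed.

Lemma hook_sum T v : hook T v = (\sum_u connect (is_parent T) u v)%N.
Proof. by rewrite /hook -sum1dep_card big_mkcond. Qed.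

(** At most one root lies above [u], so the sum is 0 or 1. *)
Lemma sum_connect_roots T S u : decreasing T -> {in S, forall s, T s = None} ->
  (\sum_(s in S) connect (is_parent T) u s)%N
  = [exists s in S, connect (is_parent T) u s].
Proof.
move=> dT rS; case: exists_inP => [[s sS us]|nS]; last first.
  by rewrite big1 // => s sS; case: (boolP (connect _ _ _)) => // us; case: nS; exists s.
rewrite (bigD1 s) //= us big1 // => r /andP[rinS ne_rs].
case: (boolP (connect _ _ _)) => // ur; case/eqP: ne_rs.
by apply: (@connect_root_uniq T u); rewrite ?rS.
Qed.

(* Forests on the labels 1, ..., i: the ordinals u >= i are kept in the type   *)
(* as isolated vertices, which roots and forest_wt ignore.                     *)
Definition forests (i : nat) : {set parent_fun n} :=
  [set T | [&& decreasing T, unary_binary T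
             & [forall u, forall v, is_parent T u v ==> (v < i)%N]]].

Definition roots (i : nat) T : {set 'I_n} := [set u : 'I_n | (u < i)%N && (T u == None)].

Lemma forestsP (i : nat) T :
  reflect [/\ decreasing T, unary_binary T &
              forall u v, T u = Some v -> (v < i)%N] (T \in forests i).
Proof.
rewrite inE; apply: (iffP and3P) => [] [dT bT iT]; split => //.
  by move=> u v Tu; move/forallP/(_ u)/forallP/(_ v): iT; rewrite /is_parent /= Tu eqxx.
by apply/forallP => u; apply/forallP => v; apply/implyP => /eqP /iT.
Qed.

Lemma forests_None (i : nat) T u : T \in forests i -> (i <= u)%N -> T u = None.
Proof.
case/forestsP => /decreasingP dT _ iT iu; case E: (T u) => [v|//].
by have := leq_trans (iT _ _ E) (leq_trans iu (ltnW (dT _ _ E))); rewrite ltnn.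
Qed.

Lemma connect_below (i : nat) T u v : T \in forests i ->
  (u < i)%N -> connect (is_parent T) u v -> (v < i)%N.
Proof.
case/forestsP => dT _ iT; elim/(decreasing_ind dT): u => // u IH ui.
rewrite connect_parentE => /orP[/eqP<- //|].
by case E: (T u) => [p|//]; apply: IH => //; apply: iT E.
Qed.

(** The trees of the forest partition the vertices below [i]: exchanging the sums, each such vertex
    is counted at its root only. *)
Lemma sum_hook_roots (i : nat) T : (i <= n)%N -> T \in forests i ->
  (\sum_(r in roots i T) hook T r = i)%N.
Proof.
move=> le_in Ti; have [dT _ iT] := forestsP _ _ Ti.
under eq_bigr do rewrite hook_sum.
rewrite exchange_big /= -[RHS]card_ord -sum1_card.
rewrite (big_ord_widen _ (fun=> 1%N) le_in) [RHS]big_mkcond.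
apply: eq_bigr => u _.
rewrite sum_connect_roots //; last by move=> s; rewrite inE => /andP[_ /eqP].
case: exists_inP => [[r]|nr].
  by rewrite inE => /andP[ri _] /(connect_leq dT) ur; rewrite (leq_ltn_trans ur ri).
case: ltnP => // ui; case: nr.
have [r Tr ur] := connect_root_exists u dT; exists r => //.
by rewrite inE Tr eqxx andbT (connect_below Ti ui ur).
Qed.

Lemma roots_gt0 (i : nat) T : (0 < i <= n)%N ->
  T \in forests i -> (0 < #|roots i T|)%N.
Proof.
case/andP=> i0 le_in Ti; case: posnP => // /eqP; rewrite cards_eq0 => /eqP R0.
by have := sum_hook_roots le_in Ti; rewrite R0 big_set0 => i_eq0; rewrite -i_eq0 in i0.
Qed.

(** * Grafting a new vertex, and its inverse *)

(** For empty [S] nothing changes in [T]: vertex [i], so far isolated and ignored, merely starts to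
    count as a root. *)
Definition graft (i : 'I_n) T S : parent_fun n :=
  [ffun u => if u \in S then Some i else T u].

Definition prune (i : 'I_n) T : parent_fun n :=
  [ffun u => if T u == Some i then None else T u].

Lemma in_children T u v : (u \in children T v) = (T u == Some v).
Proof. by rewrite inE. Qed.

Lemma graft_prune i T : graft i (prune i T) (children T i) = T.
Proof.
by apply/ffunP => u; rewrite !ffunE in_children; case: eqP => [->|].
Qed.

Section Graft.

Variables (i : 'I_n) (T : parent_fun n) (S : {set 'I_n}).
Hypotheses (Ti : T \in forests i) (rS : S \subset roots i T).

Lemma graft_roots s : s \in S -> (s < i)%N /\ T s = None.
Proof. by move/(subsetP rS); rewrite inE => /andP[-> /eqP]. Qed.

Lemma forests_not_parent u : T u != Some i.
Proof.
by apply/eqP=> Tu; have [_ _ /(_ _ _ Tu)] := forestsP _ _ Ti; rewrite ltnn.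
Qed.

Lemma prune_graft : prune i (graft i T S) = T.
Proof.
apply/ffunP => u; rewrite !ffunE; case: (boolP (u \in S)) => [uS|_].
  by rewrite eqxx; case: (graft_roots uS).
by rewrite (negPf (forests_not_parent u)).
Qed.

Lemma children_graft : children (graft i T S) i = S.
Proof.
apply/setP => u; rewrite in_children ffunE; case: ifP => _; first by rewrite eqxx.
exact/negbTE/forests_not_parent.
Qed.

Lemma graft_decreasing : decreasing (graft i T S).
Proof.
have [/decreasingP dT _ _] := forestsP _ _ Ti.
apply/decreasingP => u v; rewrite ffunE; case: ifP => [uS [<-]|_ /dT //].
by case: (graft_roots uS).
Qed.

Lemma graft_forests : (#|S| <= 2)%N -> graft i T S \in forests i.+1.
Proof.
move=> S2; have [_ /forallP bT iT] := forestsP _ _ Ti.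
apply/forestsP; split; first exact: graft_decreasing.
  apply/forallP => v; have [->|ne_vi] := eqVneq v i; first by rewrite children_graft.
  apply: leq_trans (bT v); apply/subset_leq_card/subsetP => u.
  rewrite !in_children ffunE; case: ifP => // _ /eqP[iv].
  by rewrite iv eqxx in ne_vi.
move=> u v; rewrite ffunE; case: ifP => [_ [<-] //|_ /iT].
exact: ltnW.
Qed.

Lemma connect_graft_below u v : (v < i)%N ->
  connect (is_parent (graft i T S)) u v = connect (is_parent T) u v.
Proof.
move=> vi; elim/(decreasing_ind graft_decreasing): u => u IH.
rewrite connect_parentE [RHS]connect_parentE ffunE.
move: IH; rewrite ffunE; case: ifP => [uS IH|_ IH]; last first.
  by case E: (T u) => [p|] //; rewrite IH.
(* The new edge leads from [u] to [i], which has no parent and differs from [v], so it opens no path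
   to [v]. *)
have [_ ->] := graft_roots uS; rewrite IH // connect_parentE.
by rewrite (forests_None Ti (leqnn i)) -[i == v]val_eqE /= (gtn_eqF vi).
Qed.

Lemma connect_graft_top u : connect (is_parent (graft i T S)) u i =
  (u == i) || [exists s in S, connect (is_parent T) u s].
Proof.
elim/(decreasing_ind graft_decreasing): u => u IH.
rewrite connect_parentE; congr (_ || _); move: IH; rewrite ffunE.
case: (boolP (u \in S)) => [uS _|uS IH].
  by rewrite connect0; symmetry; apply/exists_inP; exists u.
(* Since [u] is outside [S], a path from [u] to [s] is never empty. *)
have ex_parent s : s \in S -> connect (is_parent T) u s =
    (if T u is Some p then connect (is_parent T) p s else false).
  by move=> sS; rewrite connect_parentE; case: eqP => // us; rewrite us sS in uS.
case E: (T u) IH => [p|] IH.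
  rewrite IH //; case: eqP => [pi|_].
    by have := forests_not_parent u; rewrite E pi eqxx.
  by apply: eq_existsb => s; case: (boolP (s \in S)) => // /ex_parent; rewrite E => ->.
by symmetry; apply/exists_inP => -[s sS]; rewrite ex_parent // E.
Qed.

Lemma hook_graft_below v : (v < i)%N -> hook (graft i T S) v = hook T v.
Proof.
by move=> vi; apply: eq_card => u; rewrite !inE connect_graft_below.
Qed.

Lemma hook_graft_top : hook (graft i T S) i = (\sum_(s in S) hook T s).+1.
Proof.
have [dT _ _] := forestsP _ _ Ti.
rewrite -add1n hook_sum; under [in RHS]eq_bigr do rewrite hook_sum.
rewrite [in RHS]exchange_big (bigD1 i) //= connect0 [in RHS](bigD1 i) //= [X in (_ = 1 + (X + _))%N]big1 ?add0n.
  congr addn; apply: eq_bigr => u ne_ui.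
  rewrite connect_graft_top (negPf ne_ui) sum_connect_roots //.
  by move=> s /graft_roots[].
(* On the right the term of [i] itself vanishes: [i] cannot lie below [s], as s < i. *)
move=> s sS; case: (boolP (connect _ _ _)) => // /(connect_leq dT).
by rewrite leqNgt; case: (graft_roots sS) => ->.
Qed.

Lemma card_roots_graft : #|roots i.+1 (graft i T S)| = (#|roots i T| - #|S|).+1.
Proof.
rewrite (cardsD1 i) inE ltnS leqnn ffunE.
have -> : i \in S = false.
  by apply/negP => /graft_roots[]; rewrite ltnn.
rewrite (forests_None Ti (leqnn i)) eqxx add1n; congr _.+1.
rewrite -(cardsDS rS); apply: eq_card => u.
rewrite !inE ffunE ltnS; have [->|ne_ui] := eqVneq u i; first by rewrite ltnn andbF.
by rewrite [(u < i)%N]ltn_neqAle val_eqE ne_ui /=; case: (u \in S); rewrite ?eqxx ?andbF.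
Qed.

End Graft.

(** * Decomposition of a forest at its last vertex *)

Lemma prune_forests i T : T \in forests i.+1 -> prune i T \in forests i.
Proof.
case/forestsP => /decreasingP dT /forallP bT iT; apply/forestsP; split.
- by apply/decreasingP => u v; rewrite ffunE; case: ifP => // _ /dT.
- apply/forallP => v; apply: leq_trans (bT v).
  apply/subset_leq_card/subsetP => u; rewrite !in_children ffunE.
  by case: ifP.
- move=> u v; rewrite ffunE; case: eqP => // Tu Tuv.
  have := iT _ _ Tuv; rewrite ltnS leq_eqVlt => /predU1P[vi|//].
  by case: Tu; rewrite Tuv; congr Some; apply: val_inj.
Qed.

Lemma graft_fiberE i T S : T \in forests i ->
  [&& graft i T S \in forests i.+1, prune i (graft i T S) == T
    & children (graft i T S) i == S]
  = (S \subset roots i T) && (#|S| <= 2)%N.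
Proof.
move=> Ti; apply/and3P/andP => [[/forestsP[dG bG _] /eqP pG /eqP cG]|[rS S2]].
  split; last by rewrite -cG; apply: (forallP bG).
  (* Pruning the graft clears the parent of [s], and decrease along the edge from [s] to [i] gives s
     < i. *)
  apply/subsetP => s sS; rewrite inE -pG !ffunE sS !eqxx andbT.
  by apply: (decreasingP _ dG); rewrite ffunE sS.
by rewrite graft_forests // prune_graft // children_graft.
Qed.

(** A forest on i + 1 labels amounts to its pruning together with the set of children of [i]. *)
Lemma sum_forestsS (V : nmodType) i (F : parent_fun n -> V) :
  \sum_(T in forests i.+1) F T =
  \sum_(T in forests i)
    \sum_(S : {set 'I_n} | (S \subset roots i T) && (#|S| <= 2)%N) F (graft i T S).
Proof.
rewrite (partition_big (prune i) (mem (forests i))) => [|T]; last exact: prune_forests.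
apply: eq_bigr => T Ti.
rewrite (reindex_onto (graft i T) (fun T' => children T' i)) => [|T' /andP[_ /eqP<-]].
  by apply: eq_bigl => S; rewrite -andbA graft_fiberE.
exact: graft_prune.
Qed.

(** In a decreasing forest every vertex reaches some root, so being a tree means having exactly one
    root. *)
Lemma andre_treesE : andre_trees n = [set T in forests n | #|roots n T| == 1%N].
Proof.
apply/setP => T; rewrite in_set [RHS]in_set.
have inR u : (u \in roots n T) = (T u == None) by rewrite inE ltn_ord.
apply/and3P/andP => [[/existsP[r /andP[/eqP Tr /forallP ur]] dT bT]|[Tn /cards1P[r Rr]]].
  split; first by apply/forestsP; split.
  apply/cards1P; exists r; apply/setP => u; rewrite inR inE.
  apply/eqP/eqP => [Tu|->//].
  by apply: (connect_root_uniq dT Tu Tr) (ur u).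
have [dT bT _] := forestsP _ _ Tn; split=> //; apply/existsP; exists r.
rewrite -inR Rr set11; apply/forallP => u.
have [s /eqP] := connect_root_exists u dT.
by rewrite -inR Rr inE => /eqP->.
Qed.

(** * Weights of forests and of a grafted vertex *)

Section Weights.

Variables (R : comNzRingType) (x : nat -> R).

(** Leaves get weight 1, so that the filtered product in [wt] runs over all vertices. *)
Definition vertex_wt (a : R) (h : nat) : R :=
  if (1 < h)%N then a * (h - 1)%N%:R + 2%:R else 1.

Definition forest_wt (i : nat) T : R :=
  \prod_(v < n | (v < i)%N) vertex_wt (x v) (hook T v).

Lemma forest_wt_graft i T S : T \in forests i -> S \subset roots i T ->
  forest_wt i.+1 (graft i T S) =
  vertex_wt (x i) (\sum_(s in S) hook T s).+1 * forest_wt i T.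
Proof.
move=> Ti rS; rewrite /forest_wt (bigD1 i) //= hook_graft_top //; congr (_ * _).
apply: eq_big => v; first by rewrite ltnS [RHS]ltn_neqAle andbC.
by rewrite ltnS andbC -ltn_neqAle => vi; rewrite hook_graft_below.
Qed.

Lemma hook_gt0 T v : (0 < hook T v)%N.
Proof. by apply/card_gt0P; exists v; rewrite inE connect0. Qed.

(** The empty set is set apart because the affine formula would give 2 there instead of 1. *)
Lemma vertex_wt_graft (a : R) T S : S != set0 ->
  vertex_wt a (\sum_(s in S) hook T s).+1 =
  a * (\sum_(s in S) hook T s)%N%:R + 2%:R.
Proof.
case/set0Pn => s sS; rewrite /vertex_wt subn1 ltnS (bigD1 s) //=.
by rewrite ltn_addr // hook_gt0.
Qed.

Lemma sum_vertex_wt_card i T k (a : R) : T \in forests i ->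
  \sum_(S : {set 'I_n} | (S \subset roots i T) && (#|S| == k.+1))
     vertex_wt a (\sum_(s in S) hook T s).+1
  = a * (i * 'C(#|roots i T|.-1, k))%N%:R + 2%:R * 'C(#|roots i T|, k.+1)%:R.
Proof.
move=> Ti; transitivity (\sum_(S : {set 'I_n} | (S \subset roots i T) && (#|S| == k.+1))
     (a * (\sum_(s in S) hook T s)%N%:R + 2%:R)).
  apply: eq_bigr => S /andP[_ /eqP cS]; apply: vertex_wt_graft.
  by rewrite -card_gt0 cS.
rewrite big_split /= -big_distrr /= -natr_sum sum_draws_sum.
rewrite (sum_hook_roots (ltnW (ltn_ord i)) Ti) mulnC; congr (_ + _).
by rewrite sumr_const -cards_draws mulr_natr; congr (_ *+ _); apply: eq_card => S; rewrite !inE.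
Qed.

Lemma sum_vertex_wt i T (a : R) (G : nat -> R) : T \in forests i ->
  \sum_(S : {set 'I_n} | (S \subset roots i T) && (#|S| <= 2)%N)
     vertex_wt a (\sum_(s in S) hook T s).+1 * G #|S|
  = let k := #|roots i T| in
    G 0%N + (a * i%:R + 2%:R * k%:R) * G 1%N
    + (a * (i * k.-1)%N%:R + 2%:R * 'C(k, 2)%:R) * G 2%N.
Proof.
move=> Ti /=; set k := #|_|.
have draws j :
  \sum_(S : {set 'I_n} | (S \subset roots i T) && (#|S| == j))
     vertex_wt a (\sum_(s in S) hook T s).+1 * G #|S|
  = (\sum_(S : {set 'I_n} | (S \subset roots i T) && (#|S| == j))
     vertex_wt a (\sum_(s in S) hook T s).+1) * G j.
  by rewrite big_distrl; apply: eq_bigr => S /andP[_ /eqP->].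
rewrite sum_subset_card_le; under eq_bigr do rewrite draws.
rewrite !big_ord_recl big_ord0 addr0 /= addrA !sum_vertex_wt_card // -/k.
rewrite bin0 bin1 muln1 (big_pred1 set0) => [|S]; last first.
  by rewrite cards_eq0 andb_idl // => /eqP->; apply: sub0set.
by rewrite big_set0 /vertex_wt ltnn mul1r -[bump 0 0]/1%N -[bump 0 1]/2%N bin1.
Qed.

End Weights.

End Forests.

(** * The recurrence in the number of roots and the conserved sum *)

Section Invariant.

Variables (R : comNzRingType) (x : nat -> R) (n : nat).

(* The total weight of the ways to complete a forest on the labels 1, ..., i   *)
(* with k >= 1 roots to a single tree on n vertices, found by solving the      *)
(* recurrence root_count_wtS downwards from i = n.                             *)
Definition root_count_wt (i k : nat) : R :=
  ((n - i) ^_ k.-1)%N%:R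
  * \prod_(i <= j < n) (j%:R * x j + (n + 1 - j)%N%:R).

Definition weighted_sum i : R :=
  \sum_(T in forests n i) forest_wt x i T * root_count_wt i #|roots i T|.

(** The coefficient of [x i] is [ffact_succ_pred], the remainder [ffact_second_difference]. For k =
    1 the value at 0 roots is meaningless, but its coefficient is zero. *)
Lemma root_count_wtS i k : (i < n)%N -> (0 < k)%N ->
  root_count_wt i k =
  root_count_wt i.+1 k.+1 + (x i * i%:R + 2%:R * k%:R) * root_count_wt i.+1 k
  + (x i * (i * k.-1)%N%:R + 2%:R * 'C(k, 2)%:R) * root_count_wt i.+1 k.-1.
Proof.
case: k => // k lt_in _; rewrite /root_count_wt /= [in LHS]big_ltn //.
set P := \prod_(_ <= _ < _) _.
have [m m1] : exists m, (n - i = m.+1)%N.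
  by exists (n - i).-1; rewrite prednK // subn_gt0.
have -> : (n + 1 - i = m.+2)%N by rewrite addn1 subSn ?m1 // ltnW.
rewrite m1 (_ : (n - i.+1)%N = m); last by rewrite subnS m1.
have -> : 2%:R * 'C(k.+1, 2)%:R = (k.+1 * k)%N%:R :> R.
  by rewrite -natrM -(mul_bin_diag k.+1 1) bin1.
rewrite mulrA mulrDr mulrC -natrM [(_ * m.+2)%N]mulnC ffact_second_difference.
rewrite ffact_succ_pred -muln2 !natrD !natrM.
ring.
Qed.

Lemma weighted_sumS (i : 'I_n) : (0 < i)%N -> weighted_sum i.+1 = weighted_sum i.
Proof.
move=> i0; rewrite /weighted_sum sum_forestsS; apply: eq_bigr => T Ti.
have k0 : (0 < #|roots i T|)%N by apply: roots_gt0 Ti; rewrite i0 ltnW.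
rewrite root_count_wtS //.
(* Grafting a set of j roots turns k roots into k - j + 1. *)
have := sum_vertex_wt (x i) (fun j => root_count_wt i.+1 (#|roots i T| - j).+1) Ti.
rewrite /= subn0 subn1 subn2 prednK // => e.
transitivity (forest_wt x i T *
  (\sum_(S : {set 'I_n} | (S \subset roots i T) && (#|S| <= 2)%N)
     vertex_wt (x i) (\sum_(s in S) hook T s).+1
     * root_count_wt i.+1 (#|roots i T| - #|S|).+1)).
  rewrite big_distrr /=; apply: eq_bigr => S /andP[rS _].
  by rewrite forest_wt_graft // card_roots_graft // mulrA [vertex_wt _ _ * _]mulrC.
(* For two children the counts [k.-2.+1] and [k.-1] differ at k = 1, but [root_count_wt] sees only
   their predecessors, which are convertible. *)
by rewrite e.
Qed.

Lemma weighted_sum1 : (0 < n)%N -> weighted_sum 1 = root_count_wt 1 1.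
Proof.
move=> n0; pose T0 : parent_fun n := [ffun=> None].
have T0f : T0 \in forests n 1.
  apply/forestsP; split.
  - by apply/decreasingP => u v; rewrite ffunE.
  - apply/forallP => v; rewrite (_ : children _ v = set0) ?cards0 //.
    by apply/setP => u; rewrite in_children ffunE inE.
  - by move=> u v; rewrite ffunE.
have hookT0 v : hook T0 v = 1%N.
  rewrite /hook -(cards1 v); apply: eq_card => u.
  by rewrite !inE connect_parentE ffunE orbF.
rewrite /weighted_sum (big_pred1 T0) => [|T]; last first.
  apply/idP/eqP => [T1|-> //].
  apply/ffunP => u; rewrite ffunE; case: (posnP u) => [u0|]; last exact: forests_None T1.
  have [/decreasingP dT _ iT] := forestsP _ _ T1.
  by case E: (T u) => [v|//]; have := leq_trans (dT _ _ E) (iT _ _ E); rewrite u0.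
(* As all hooks are 1, the sum of the hooks of the roots counts the roots: there is one. *)
have := sum_hook_roots n0 T0f; rewrite (eq_bigr _ (fun v _ => hookT0 v)) sum1_card => ->.
by rewrite /forest_wt big1 ?mul1r // => v _; rewrite hookT0.
Qed.

Lemma sum_andre_forest_wt : (0 < n)%N ->
  \sum_(T in andre_trees n) forest_wt x n T =
  \prod_(1 <= i < n) (i%:R * x i + (n + 1 - i)%N%:R).
Proof.
move=> n0.
have sumE m : (m < n)%N -> weighted_sum m.+1 = weighted_sum 1.
  by elim: m => // m IH mn; rewrite (@weighted_sumS (Ordinal mn)) // IH // ltnW.
have := sumE n.-1; rewrite prednK // leqnn => /(_ isT).
rewrite weighted_sum1 // /root_count_wt ffactn0 mul1r => <-.
rewrite andre_treesE big_mkcond /= /weighted_sum [RHS]big_mkcond /=.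
apply: eq_bigr => T _; rewrite in_set; case: (boolP (T \in _)) => //= Tn.
rewrite /root_count_wt subnn big_geq // mulr1.
(* The falling factorial of 0 of length [k.-1] is 0 for k >= 2, and 1 for k = 1 but also for k = 0,
   which must be excluded. *)
have : (0 < #|roots n T|)%N by apply: roots_gt0 Tn; rewrite n0 leqnn.
case: #|roots n T| => [|[|k]] //= _; last by rewrite ffact_small // mulr0.
by rewrite mulr1.
Qed.

End Invariant.

Theorem theorem15 (n : nat) (hn : (1 <= n)%N) :
  \sum_(T in andre_trees n) wt T =
  \prod_(1 <= i < n) (i%:R * indet i + (n + 1 - i)%N%:R).
Proof.
rewrite -(sum_andre_forest_wt indet hn); apply: eq_bigr => T _.
rewrite /wt big_mkcond; apply: eq_big => [v|v _]; first by rewrite ltn_ord.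
by rewrite /vertex_wt.
Qed.
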